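(* Let $M\subseteq\mathbb{Z}^q_{\geq0}$ be an affine monoid. There exists a face $\mathcal{F}_M$ of $C(M)$ such that $M\setminus\mathcal{P}(M)=M\cap\mathcal{F}_M$. Moreover, the monoid $M\cap\mathcal{F}_M$ is normal.
   Context: An affine monoid $M\subseteq\mathbb{Z}^q_{\geq 0}$ ($q$ a positive integer) is a finitely generated submonoid of $\mathbb{Z}^q$ contained in $\mathbb{Z}^q_{\geq0}$. $\mathbb{Z}M$ is the group generated by $M$, and $C(M)=\mathbb{R}_{\geq0}M$ is the cone generated by $M$. A monoid $N$ is normal if $C(N)\cap\mathbb{Z}N=N$. For an integer $m>1$, $\frac1mM=\{\gamma/m:\gamma\in M\}$ and $$V_m(M)=\left\{\alpha\in\tfrac1mM \;\middle|\; \left(\tfrac1mM-\alpha\right)\cap\mathbb{Z}M\subseteq M\right\}.$$ The pure prime of $M$ is $\mathcal{P}(M)=M\setminus\bigcup_{m>1}mV_m(M)$. Convention: the empty set is allowed as a face of $C(M)$ (it occurs as $\mathcal{F}_M$ when $\mathcal{P}(M)=M$), and in that case the normality assertion is vacuous. *)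

(* Defs.v *)
(* Z^q and (1/m)Z^q are viewed inside R^q, represented as row vectors. *)
From HB Require Import structures.
From mathcomp Require Import all_boot all_order all_algebra.
From mathcomp Require Import all_classical all_reals.

Set Implicit Arguments.
Unset Strict Implicit.
Unset Printing Implicit Defensive.

Import Order.TTheory GRing.Theory Num.Theory.

Local Open Scope classical_set_scope.
Local Open Scope ring_scope.

Section AffineMonoid.
Context {R : realType} {q : nat}.
Implicit Types (N M C F S : set 'rV[R]_q).

Definition submonoid N := N 0 /\ (forall x y, N x -> N y -> N (x + y)).

Definition subgroup N := submonoid N /\ (forall x, N x -> N (- x)).

Definition affine_monoid M :=
  (exists2 S, finite_set S & M = smallest submonoid S) /\
  (forall x, M x -> x \is a mxOver Num.nat).

Definition group_gen N : set 'rV[R]_q := smallest subgroup N.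

Definition cone N : set 'rV[R]_q :=
  [set v | exists (n : nat) (a : 'I_n -> R) (x : 'I_n -> 'rV[R]_q),
     [/\ forall i, 0 <= a i, forall i, N (x i) & v = \sum_(i < n) a i *: x i]].

(* The intersection of C with the zero locus of an affine inequality valid
   on C. The choice c = 0 makes both C (b = 0) and set0 (b < 0) faces. *)
Definition face C F := exists (c : 'cV[R]_q) (b : R),
  (forall x, C x -> b <= (x *m c) 0 0) /\
  F = C `&` [set x | (x *m c) 0 0 = b].

Definition normal_monoid N := submonoid N /\ cone N `&` group_gen N = N.

Definition frac (m : nat) M : set 'rV[R]_q := [set m%:R^-1 *: g | g in M].

Definition V_ (m : nat) M : set 'rV[R]_q :=
  [set alpha | frac m M alpha /\
     [set beta - alpha | beta in frac m M] `&` group_gen M `<=` M].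

Definition pure_prime M : set 'rV[R]_q :=
  M `\` \bigcup_(m in [set m : nat | (1 < m)%N]) [set m%:R *: v | v in V_ m M].

End AffineMonoid.

(* Main.v *)
(* Put A = M \ P(M). A vector g of M lies in A iff some m > 1 satisfies: for
   all u in ZM, g + m u in M implies u in M. Such A is closed under sums and
   under taking summands in M, so unless it is empty it is a face of the monoid
   M. By Farkas' lemma over the rationals it is cut out of M by a linear form
   that is nonnegative on M. For normality, let u in ZA lie in the cone of A,
   say u = d - b with b, d in A, and k u in A for some k > 0. Then
   k b + j u lies in A for all j; taking for j the m attached to k b in A
   gives u in M, and u + b = d then gives u in A. *)
Require Import Defs.
From HB Require Import structures.
From mathcomp Require Import all_boot all_order all_algebra.
From mathcomp Require Import all_classical all_reals.

Set Implicit Arguments.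
Unset Strict Implicit.
Unset Printing Implicit Defensive.

Import Order.TTheory GRing.Theory Num.Theory.

Local Open Scope classical_set_scope.
Local Open Scope ring_scope.

(* Bartl's induction: if [c] separates [u] from [s] but is negative on [a],
   project everything along [a] onto the kernel of [c]. *)
Lemma farkas (K : realFieldType) (q : nat) (s : seq 'rV[K]_q) (u : 'rV[K]_q) :
  (exists2 l : seq K, all (>= 0) l & u = \sum_(i < size s) l`_i *: s`_i) \/
  (exists2 c : 'cV[K]_q, {in s, forall x, 0 <= (x *m c) 0 0} & (u *m c) 0 0 < 0).
Proof.
have mulE (x y : 'rV[K]_q) k c : ((x - k *: y) *m c) 0 0
    = (x *m c) 0 0 - k * (y *m c) 0 0 by rewrite mulmxBl -scalemxAl !mxE.
have mulrE (x : 'rV[K]_q) k c d : (x *m (d - k *: c)) 0 0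
    = (x *m d) 0 0 - k * (x *m c) 0 0 by rewrite mulmxBr -scalemxAr !mxE.
have [n] := ubnP (size s); elim: n s u => // n IHn [|a s] u /=.
  move=> _; have [->|u_neq0] := eqVneq u 0.
    by left; exists [::] => //; rewrite big_ord0.
  (* With no vectors left, the form [- u^T] takes at [u] minus the sum of the squares of its
     entries. *)
  right; exists (- u^T) => //; rewrite mulmxN mxE oppr_lt0 mxE.
  rewrite lt_def sumr_ge0 ?andbT => [|i _]; last by rewrite mxE -expr2 sqr_ge0.
  apply: contra u_neq0; rewrite psumr_eq0 => [/allP u0|i _]; last first.
    by rewrite mxE -expr2 sqr_ge0.
  apply/eqP/rowP => i; rewrite mxE; apply/eqP.
  by have := u0 i (mem_index_enum _); rewrite mxE mulf_eq0 orbb.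
move=> lt_s_n; case: (IHn s u lt_s_n) => [[l l_ge0 ->]|[c s_ge0 u_lt0]].
  left; exists (0 :: l); first by rewrite /= lexx.
  by rewrite big_ord_recl /= scale0r add0r.
have [a_ge0|a_lt0] := leP 0 ((a *m c) 0 0).
  by right; exists c => // x; rewrite inE => /predU1P[->|/s_ge0].
pose r (x : 'rV[K]_q) := (x *m c) 0 0 / (a *m c) 0 0.
pose f x := x - r x *: a.
have := IHn (map f s) (f u); rewrite size_map => /(_ lt_s_n).
case=> [[l l_ge0 fu]|[d fs_ge0 fu_lt0]].
  (* [l] may be shorter than [s]; missing coefficients are read as the default 0. *)
  have l_i_ge0 i : 0 <= l`_i.
    have [lti|lei] := ltnP i (size l); last by rewrite nth_default.
    by apply: (allP l_ge0); rewrite mem_nth.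
  (* Solving the relation between projections for [u] gives this coefficient of [a]. It is
     nonnegative since [r] is positive at [u] and nonpositive on [s]. *)
  left; exists ((r u - \sum_(i < size s) l`_i * r s`_i) :: l).
    rewrite /= l_ge0 andbT subr_ge0 (@le_trans _ _ 0) //.
      apply: sumr_le0 => i _; rewrite mulr_ge0_le0 ?l_i_ge0 //.
      by rewrite mulr_ge0_le0 ?s_ge0 ?mem_nth // invr_le0 ltW.
    by rewrite mulr_le0 ?invr_le0 // ltW.
  rewrite big_ord_recl /=; move/eqP: fu; rewrite subr_eq => /eqP {1}->.
  under [X in X + _ = _]eq_bigr do rewrite (nth_map 0) // /f scalerBr scalerA.
  by rewrite sumrB -scaler_suml scalerBl -addrA [- _ + _]addrC addrC.
(* Composing [d] with the projection [f] gives a form that vanishes at [a]. *)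
have fE x : (f x *m d) 0 0 =
    (x *m (d - ((a *m d) 0 0 / (a *m c) 0 0) *: c)) 0 0.
  by rewrite mulE mulrE /r mulrAC [in RHS]mulrAC [(x *m c) 0 0 * _]mulrC.
right; exists (d - ((a *m d) 0 0 / (a *m c) 0 0) *: c); last by rewrite -fE.
move=> x; rewrite inE => /predU1P[->|xs]; last by rewrite -fE fs_ge0 ?map_f.
by rewrite mulrE divfK ?subrr ?lt_eqF.
Qed.

(** * Submonoids, generated groups and integral cones *)

Section Monoids.
Context {R : realType} {q : nat}.
Implicit Types (M N S A : set 'rV[R]_q).

Lemma mxOver_intB (x y : 'rV[R]_q) : x \is a mxOver Num.int ->
  y \is a mxOver Num.int -> x - y \is a mxOver Num.int.
Proof.
move=> /mxOverP x_int /mxOverP y_int; apply/mxOverP => i j.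
by rewrite !mxE rpredB ?x_int ?y_int.
Qed.

Lemma mxOver_intN (x : 'rV[R]_q) :
  x \is a mxOver Num.int -> - x \is a mxOver Num.int.
Proof. by move=> x_int; rewrite -sub0r mxOver_intB // mxOver0 ?rpred0. Qed.

Lemma submonoid_smallest S : submonoid (smallest submonoid S).
Proof.
split=> [N [[]]//|x y Sx Sy N [N_mon SN]].
by apply: N_mon.2; [apply: Sx | apply: Sy].
Qed.

Lemma submonoid_mulrn N n x : submonoid N -> N x -> N (n%:R *: x).
Proof.
move=> [N0 ND] Nx; rewrite scaler_nat.
by elim: n => [|n IHn]; rewrite ?mulr0n // mulrS; apply: ND.
Qed.

Lemma group_gen_diff N : submonoid N ->
  group_gen N `<=` [set u | exists a b, [/\ N a, N b & u = b - a]].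
Proof.
move=> [N0 ND]; apply: smallest_sub; last by move=> x Nx; exists 0, x; rewrite subr0.
split; last by move=> _ [a [b [Na Nb ->]]]; exists b, a; rewrite opprB.
split; first by exists 0, 0; rewrite subr0.
move=> _ _ [a [b [Na Nb ->]]] [a' [b' [Na' Nb' ->]]].
by exists (a + a'), (b + b'); split; [exact: ND|exact: ND|rewrite opprD addrACA].
Qed.

Lemma diff_group_gen N (a b : 'rV[R]_q) : N a -> N b -> group_gen N (b - a).
Proof.
move=> Na Nb G [[[_ GD] GN] NG].
by apply: GD; [exact: NG | apply/GN/NG].
Qed.

(* Rational coefficients, unlike real ones, can be cleared of denominators; so
   Farkas is applied over [rat], to a real dual hypothesis. *)
Lemma integral_farkas (s : seq 'rV[R]_q) (u : 'rV[R]_q) :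
  {in s, forall x, x \is a mxOver Num.int} -> u \is a mxOver Num.int ->
  (forall c : 'cV[R]_q, {in s, forall x, 0 <= (x *m c) 0 0} ->
    0 <= (u *m c) 0 0) ->
  exists2 k, (0 < k)%N & smallest submonoid [set` s] (k%:R *: u).
Proof.
(* The floor is exact on integral vectors, so [toR] undoes [toQ] there. *)
pose toQ (x : 'rV[R]_q) : 'rV[rat]_q := map_mx (fun r => (Num.floor r)%:~R) x.
pose toR (x : 'rV[rat]_q) : 'rV[R]_q := map_mx ratr x.
have toQK x : x \is a mxOver Num.int -> toR (toQ x) = x.
  move=> /mxOverP x_int; apply/rowP => i; rewrite !mxE ratr_int.
  exact: floorK.
have toRM (x : 'rV[rat]_q) c :
    (toR x *m map_mx ratr c) 0 0 = ratr ((x *m c) 0 0) by rewrite -map_mxM mxE.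
move=> s_int u_int s_dual.
have [[l /allP l_ge0 uE]|[c s_ge0 u_lt0]] := farkas (map toQ s) (toQ u); last first.
  have /s_dual : {in s, forall x, 0 <= (x *m map_mx (@ratr R) c) 0 0}.
    by move=> x xs; rewrite -[x]toQK ?s_int // toRM ler0q s_ge0 ?map_f.
  by rewrite -[u]toQK // toRM ler0q leNgt u_lt0.
have N_mon := submonoid_smallest [set` s]; have [N0 ND] := N_mon.
rewrite -[u]toQK // uE size_map.
(* Each partial sum has a positive multiple in the monoid: a single term is cleared by its
   denominator, and multipliers are multiplied when sums are added. *)
elim/big_ind: _ => [|x y [k k_gt0 Nx] [m m_gt0 Ny]|i _].
- by exists 1%N; rewrite // /toR map_mx0 scaler0.
- exists (k * m)%N; first by rewrite muln_gt0 k_gt0.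
  rewrite /toR map_mxD scalerDr; apply: ND.
    by rewrite mulnC natrM -scalerA; exact: (submonoid_mulrn _ N_mon).
  by rewrite natrM -scalerA; exact: (submonoid_mulrn _ N_mon).
- rewrite (nth_map 0) // /toR map_mxZ -/(toR _) toQK ?s_int ?mem_nth //.
  have li_ge0 : 0 <= l`_i.
    have [lti|lei] := ltnP i (size l); last by rewrite nth_default.
    by apply: l_ge0; rewrite mem_nth.
  exists `|denq l`_i|%N; first by rewrite absz_gt0 denq_neq0.
  rewrite scalerA.
  have -> : `|denq l`_i|%:R * ratr l`_i = `|numq l`_i|%:R :> R.
    rewrite !natr_absz !ger0_norm ?numq_ge0 ?denq_ge0 //.
    by rewrite mulrC /ratr divfK // intr_eq0 denq_neq0.
  apply: (submonoid_mulrn _ N_mon) => // N [_ sN]; apply: sN => /=; exact: mem_nth.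
Qed.

(** For each generator outside [A], Farkas gives a form nonnegative on [M] and zero on [A] that is
    positive there. The sum of these forms handles all generators at once, and divisibility in [A]
    extends this to [M]. *)
Lemma submonoid_face_functional M S A :
  finite_set S -> M = smallest submonoid S ->
  (forall x, M x -> x \is a mxOver Num.int) ->
  submonoid A -> (forall x y, M x -> M y -> A (x + y) -> A x) ->
  exists c : 'cV[R]_q, forall x, M x ->
    0 <= (x *m c) 0 0 /\ ((x *m c) 0 0 = 0 <-> A x).
Proof.
move=> /finite_seqP[s ->] ME M_int [A0 AD] A_div.
have M_mon : submonoid M by rewrite ME; exact: submonoid_smallest.
have sM x : x \in s -> M x by move=> xs; rewrite ME => N [_]; apply.
have sep t : exists c : 'cV[R]_q, t \in s ->
    [/\ {in s, forall x, 0 <= (x *m c) 0 0},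
        {in s, forall x, A x -> (x *m c) 0 0 = 0} & (~ A t -> 0 < (t *m c) 0 0)].
  have [ts|/negP nts] := boolP (t \in s); last by exists 0.
  have [At|nAt] := pselect (A t).
    by exists 0 => _; split=> // x _; rewrite mulmx0 mxE.
  (* A form nonnegative on [s'] is nonnegative on [s] and zero on its members in [A]. If none is
     positive at [t], then [- t] meets the dual condition. *)
  pose s' := s ++ [seq - x | x <- s & x \in A].
  apply: contra_notP nAt => /forallNP noc.
  have [||c c_ge0|k k_gt0] := @integral_farkas s' (- t).
  - move=> x; rewrite mem_cat => /orP[/sM/M_int//|/mapP[y]].
    by rewrite mem_filter => /andP[_ /sM/M_int y_int] ->; exact: mxOver_intN.
  - exact/mxOver_intN/M_int/sM.
  - rewrite leNgt; apply/negP; rewrite mulNmx mxE oppr_lt0 => tc.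
    apply: (noc c) => _; split=> // x xs; first by apply: c_ge0; rewrite mem_cat xs.
    move=> Ax; apply/eqP; rewrite eq_le c_ge0 ?mem_cat ?xs // andbT -oppr_ge0.
    have := c_ge0 (- x); rewrite mulNmx mxE; apply.
    by rewrite mem_cat map_f ?orbT // mem_filter xs andbT /= in_setE.
  (* This submonoid contains [s'], hence [- k t]; so [k t] is a summand of some [a] in [A]. *)
  move=> /(_ [set x | exists2 a, A a & M (x + a)]) [].
    split; last first.
      move=> x /=; rewrite mem_cat => /orP[/sM Mx|/mapP[y]].
        by exists 0; rewrite ?addr0.
      rewrite mem_filter => /andP[/set_mem Ay _] ->; exists y => //.
      by rewrite addNr; exact: M_mon.1.
    split; first by exists 0; rewrite // addr0; exact: M_mon.1.
    move=> x y [a Aa Ma] [b Ab Mb]; exists (a + b); first exact: AD.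
    by rewrite addrACA; exact: M_mon.2.
  move=> a Aa Ma; have Mt := sM _ ts.
  have Mkt m : M (m%:R *: t) by exact: submonoid_mulrn.
  have Akt : A (k%:R *: t).
    apply: (A_div _ (k%:R *: - t + a)) => //.
    by rewrite scalerN addrA subrr add0r.
  case: k k_gt0 Akt {Ma} => // k _; rewrite -[k.+1]add1n natrD scalerDl scale1r.
  exact: A_div.
have /choice[C CP] := sep; exists (\sum_(t <- s) C t).
have cE (x : 'rV[R]_q) : (x *m (\sum_(t <- s) C t)) 0 0 = \sum_(t <- s) (x *m C t) 0 0.
  by rewrite mulmx_sumr summxE.
(* Membership in [M] is carried through the induction because [A_div] asks for it. *)
suff c_gen : M `<=` [set x | M x /\ (0 <= (x *m (\sum_(t <- s) C t)) 0 0 /\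
    ((x *m (\sum_(t <- s) C t)) 0 0 = 0 <-> A x))] by move=> x /c_gen[].
rewrite {1}ME; apply: smallest_sub.
  split; first by rewrite /= mul0mx mxE; split; [exact: M_mon.1 | split].
  move=> x y [Mx [x_ge0 xA]] [My [y_ge0 yA]]; split; first exact: M_mon.2.
  rewrite mulmxDl mxE; split; first exact: addr_ge0.
  split=> [/eqP|Axy].
    by rewrite paddr_eq0 // => /andP[/eqP/xA Ax /eqP/yA Ay]; exact: AD.
  rewrite (xA.2 (A_div _ _ Mx My Axy)) add0r.
  by apply/yA/(A_div y x); rewrite // addrC.
move=> x /= xs; split; first exact: sM.
have c_ge0 t : t \in s -> 0 <= (x *m C t) 0 0 by move=> /CP[+ _ _]; apply.
rewrite cE big_seq; split; first exact: sumr_ge0.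
split=> [|Ax]; last by apply: big1 => t /CP[_ + _]; apply.
(* All terms of a vanishing nonnegative sum vanish, in particular the one of [C x], which is
   positive at [x] if [x] lies outside [A]. *)
move=> /eqP; rewrite psumr_eq0 // => /allP/(_ x xs); rewrite xs /= => /eqP xC0.
by apply: contrapT => nAx; have [_ _ /(_ nAx)] := CP x xs; rewrite xC0 ltxx.
Qed.

(** * The complement of the pure prime *)

(** Clearing denominators in [V_]: with [alpha = x / m] and [beta = g / m], the difference
    [u = beta - alpha] satisfies [g = x + m u]. *)
Lemma nonpureP M x : (M `\` pure_prime M) x <-> M x /\ exists2 m, (1 < m)%N &
  forall u, group_gen M u -> M (x + m%:R *: u) -> M u.
Proof.
have mK m : (1 < m)%N -> m%:R != 0 :> R by case: m => // m; rewrite pnatr_eq0.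
split=> [[Mx]|[Mx [m m_gt1 xm]]].
  rewrite /pure_prime not_andE => -[//|/contrapT[m /= m_gt1 [_ [[g Mg <-] V] xE]]].
  move: xE; rewrite scalerA mulfV ?mK // scale1r => gx.
  rewrite {}gx in Mg V; split=> //; exists m => // u Gu Mxu; apply: V; split=> //.
  exists (m%:R^-1 *: (x + m%:R *: u)); first by exists (x + m%:R *: u).
  by rewrite scalerDr scalerA mulVf ?mK // scale1r addrC addKr.
split=> // -[_]; apply; exists m => //=; exists (m%:R^-1 *: x); last first.
  by rewrite scalerA mulfV ?mK // scale1r.
split; first by exists x.
move=> _ [[_ [g Mg <-] <-] Gu]; apply: xm => //.
by rewrite scalerBr !scalerA mulfV ?mK // !scale1r addrC subrK.
Qed.

(** A witness [m] for [x + y] also serves [x]: adding [y] keeps [x + m u] in [M]. *)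
Lemma nonpure_div M x y : submonoid M -> M x -> M y ->
  (M `\` pure_prime M) (x + y) -> (M `\` pure_prime M) x.
Proof.
move=> [_ MD] Mx My /nonpureP[_ [m m_gt1 xym]]; apply/nonpureP; split=> //.
by exists m => // u Gu Mxu; apply: xym => //; rewrite addrAC; exact: MD.
Qed.

(* If [x], [y] are witnessed by [m], [n], then [x + m y] is witnessed by
   [m n], and [x + y] divides [x + m y]. *)
Lemma nonpureD M x y : submonoid M -> (M `\` pure_prime M) x ->
  (M `\` pure_prime M) y -> (M `\` pure_prime M) (x + y).
Proof.
move=> M_mon /nonpureP[Mx [m m_gt1 xm]] /nonpureP[My [n n_gt1 yn]].
apply: (@nonpure_div M _ (m.-1%:R *: y)) => //.
- exact: M_mon.2.
- exact: submonoid_mulrn.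
have -> : x + y + m.-1%:R *: y = x + m%:R *: y.
  case: m m_gt1 {xm} => // m _.
  by rewrite -[m.+1%:R]nat1r scalerDl scale1r addrA.
apply/nonpureP; split; first by apply: M_mon.2 => //; exact: submonoid_mulrn.
exists (m * n)%N; first by rewrite (leq_trans m_gt1) // leq_pmulr // ltnW.
move=> u Gu; rewrite natrM -scalerA -addrA -scalerDr => Mu.
(* The witness [m] of [x] is applied to the group element [y + n u]. *)
apply: (yn u Gu); apply: xm => // G [G_grp MG].
apply: G_grp.1.2; first exact: MG.
by apply: submonoid_mulrn G_grp.1 _; apply: Gu.
Qed.

Lemma nonpure_submonoid M : submonoid M -> M `\` pure_prime M !=set0 ->
  submonoid (M `\` pure_prime M).
Proof.
move=> M_mon [x Ax]; split; last by move=> y z; exact: nonpureD.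
by apply: (@nonpure_div M _ x) => //; [exact: M_mon.1|exact: Ax.1|rewrite add0r].
Qed.

Lemma nonpure_normal M : submonoid M ->
  (forall x, M x -> x \is a mxOver Num.int) ->
  M `\` pure_prime M !=set0 -> normal_monoid (M `\` pure_prime M).
Proof.
set A := M `\` pure_prime M => M_mon M_int A_neq0.
have A_mon : submonoid A by exact: nonpure_submonoid.
split=> //; apply/seteqP; split=> [u [[n [a [x [a_ge0 Ax uE]]]] Gu]|u Au]; last first.
  split; first by exists 1%N, (fun=> 1), (fun=> u); rewrite big_ord1 scale1r.
  by rewrite -[u]subr0; apply: diff_group_gen => //; exact: A_mon.1.
have [b [d [Ab Ad ubd]]] := group_gen_diff A_mon Gu.
suff Mu : M u.
  by apply: (@nonpure_div M _ b) => //; [exact: Ab.1|rewrite ubd subrK].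
(* The real combination supplies only the dual condition; the result is an integral multiple [k u]
   in [A]. *)
have [||c c_ge0|k k_gt0 ku] := @integral_farkas [seq x i | i <- enum 'I_n] u.
- by move=> _ /mapP[i _ ->]; apply/M_int; case: (Ax i).
- by rewrite ubd mxOver_intB // M_int //; [case: Ad|case: Ab].
- rewrite uE mulmx_suml summxE sumr_ge0 // => i _.
  by rewrite -scalemxAl [leRHS]mxE mulr_ge0 // c_ge0 // map_f // mem_enum.
have {ku} Aku : A (k%:R *: u).
  by apply: ku; split=> // _ /mapP[i _ ->].
(* Split off multiples of [k u]; for the remainder [r = j %% k], [k b + r u = (k - r) b + r d]. *)
have Aju j : A (k%:R *: b + j%:R *: u).
  rewrite (divn_eq j k) natrD scalerDl natrM -scalerA addrCA; apply: A_mon.2.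
    exact: submonoid_mulrn.
  have lejk : (j %% k <= k)%N by rewrite ltnW // ltn_mod.
  have -> : k%:R *: b = (k - j %% k)%:R *: b + (j %% k)%:R *: b.
    by rewrite -scalerDl -natrD subnK.
  rewrite -addrA -scalerDr ubd [b + _]addrC subrK.
  by apply: A_mon.2; apply: submonoid_mulrn.
have /nonpureP[_ [m _ bm]] : A (k%:R *: b) by exact: submonoid_mulrn.
apply: bm; last by case: (Aju m).
by rewrite ubd; apply: diff_group_gen; [case: Ab|case: Ad].
Qed.

End Monoids.

Theorem corollary3p28 (R : realType) (q : nat) (q_gt0 : (0 < q)%N)
    (M : set 'rV[R]_q) (affM : affine_monoid M) :
  exists F : set 'rV[R]_q,
    [/\ face (cone M) F,
        M `\` pure_prime M = M `&` F &
        F !=set0 -> normal_monoid (M `&` F)].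
Proof.
have [[S S_fin ME] M_nat] := affM.
have M_mon : submonoid M by rewrite ME; exact: submonoid_smallest.
have M_int x : M x -> x \is a mxOver Num.int.
  by move=> /M_nat/mxOverP x_nat; apply/mxOverP => i j; apply/intr_nat/x_nat.
have [A0|/set0P A_neq0] := eqVneq (M `\` pure_prime M) set0.
  exists set0; split; last by move=> [].
    (* The zero form never attains the valid lower bound -1, so it cuts out the empty face. *)
    exists 0, (-1); split=> [x _|]; first by rewrite mulmx0 mxE lerN10.
    apply/seteqP; split=> // x [_ /=]; rewrite mulmx0 mxE => /eqP.
    by rewrite eq_sym oppr_eq0 oner_eq0.
  by rewrite A0 setI0.
have [|c cP] := submonoid_face_functional S_fin ME M_int
    (nonpure_submonoid M_mon A_neq0).
  by move=> x y; exact: nonpure_div.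
have AE : M `\` pure_prime M = M `&` (cone M `&` [set x | (x *m c) 0 0 = 0]).
  apply/seteqP; split=> [x Ax|x [Mx [_ /(cP x Mx).2]]//].
  split; first exact: Ax.1.
  split; last by apply/(cP x Ax.1).2.
  by exists 1%N, (fun=> 1), (fun=> x); rewrite big_ord1 scale1r; split=> // _; exact: Ax.1.
exists (cone M `&` [set x | (x *m c) 0 0 = 0]); split=> //.
  exists c, 0; split=> // _ [n [a [x [a_ge0 Mx ->]]]].
  rewrite mulmx_suml summxE sumr_ge0 // => i _.
  by rewrite -scalemxAl [leRHS]mxE mulr_ge0 //; case: (cP _ (Mx i)).
by rewrite -AE => _; exact: nonpure_normal.
Qed.
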